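(* The state space of the maximal tensor product of two pentagon systems has exactly $135$ extreme points. Exactly $25$ of them are the product states $\omega_i\omega_j^{\mathrm T}$, $i,j\in\{1,\dots,5\}$, and the remaining $110$ are entangled. Under local reversible transformations the $110$ extreme entangled states form exactly two equivalence classes: one with $10$ elements, containing $\Phi_J=I_3$ (the $3\times3$ identity matrix), and one with $100$ elements, containing $$\Phi_H=\begin{pmatrix} -\cos(\pi/5) & \frac{-r_5^6\sin(\pi/5)}{8(1+r_5^2)} & 0\\ \frac{-r_5^6\sin(\pi/5)}{8(1+r_5^2)} & \cos(\pi/5) & \frac{-r_5^3}{4\sin(\pi/5)}\\ 0&\frac{-r_5^3}{4\sin(\pi/5)}&1\end{pmatrix},\qquad r_5=\sqrt{\sec(\pi/5)}.$$
   Context: Pentagon model. The elementary state space is the convex hull in $\mathbb R^3$ of the pure states $\omega_i=(r_5\cos\frac{2\pi i}{5},\,r_5\sin\frac{2\pi i}{5},\,1)^{\mathrm T}$, $i=1,\dots,5$. The unit effect is $u=(0,0,1)^{\mathrm T}$. The ray-extremal effects (those generating the extreme rays of the cone of functionals nonnegative on all states) are $e_i=\frac{1}{1+r_5^2}(r_5\cos\frac{2\pi i}{5},\,r_5\sin\frac{2\pi i}{5},\,1)^{\mathrm T}$, $i=1,\dots,5$. The state space of the maximal tensor product is the polytope of real $3\times3$ matrices $\Phi$ with $u^{\mathrm T}\Phi u=1$ (i.e. $\Phi_{33}=1$) and $e_i^{\mathrm T}\Phi e_j\ge 0$ for all $i,j\in\{1,\dots,5\}$. An extreme point is entangled if it is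 not one of the product states $\omega_i\omega_j^{\mathrm T}$. Reversible transformations of one pentagon are the $10$ matrices $\mathcal T_k^s=\begin{pmatrix}\cos\frac{2\pi k}{5}&-s\sin\frac{2\pi k}{5}&0\\ \sin\frac{2\pi k}{5}&s\cos\frac{2\pi k}{5}&0\\0&0&1\end{pmatrix}$, $k\in\{1,\dots,5\}$, $s=\pm1$. Local reversible transformations act by $\Phi\mapsto \mathcal T_{k_1}^{s_1}\,\Phi\,(\mathcal T_{k_2}^{s_2})^{\mathrm T}$. Two entangled states are equivalent if some local reversible transformation maps one to the other. *)

(* Defs.v *)
From mathcomp Require Import all_boot all_order all_algebra.
From mathcomp Require Import all_classical all_reals all_analysis.
Set Implicit Arguments.
Unset Strict Implicit.
Unset Printing Implicit Defensive.
Import Order.TTheory GRing.Theory Num.Theory.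
Local Open Scope classical_set_scope.
Local Open Scope ring_scope.

Definition extreme_points (R : realType) (V : lmodType R) (A : set V) : set V :=
  [set x | A x /\ forall (y z : V) (t : R), A y -> A z -> 0 < t < 1 ->
    x = t *: y + (1 - t) *: z -> y = x /\ z = x].

Definition vec3 (R : realType) (a b c : R) : 'cV[R]_3 :=
  \col_(i < 3) [:: a; b; c]`_i.

Definition mx3 (R : realType) (a b c a' b' c' a'' b'' c'' : R) : 'M[R]_3 :=
  \matrix_(i < 3, j < 3)
    (nth [::] [:: [:: a; b; c]; [:: a'; b'; c']; [:: a''; b''; c'']] i)`_j.

Definition r5 (R : realType) : R := Num.sqrt (cos (pi / 5))^-1.

(* The index i : 'I_5 runs over 0, .., 4 and stands for i + 1 in {1, .., 5}. *)
Definition angle5 (R : realType) (i : 'I_5) : R := 2 * pi * (i.+1)%:R / 5.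

Definition omega (R : realType) (i : 'I_5) : 'cV[R]_3 :=
  vec3 (r5 R * cos (angle5 R i)) (r5 R * sin (angle5 R i)) 1.

Definition unit_effect (R : realType) : 'cV[R]_3 := vec3 0 0 1.

Definition ray_effect (R : realType) (i : 'I_5) : 'cV[R]_3 :=
  (1 + r5 R ^+ 2)^-1 *:
    vec3 (r5 R * cos (angle5 R i)) (r5 R * sin (angle5 R i)) 1.

(* The joint probability e^T Phi f. *)
Definition joint (R : realType) (Phi : 'M[R]_3) (e f : 'cV[R]_3) : R :=
  (e^T *m Phi *m f) 0 0.

Definition max_tensor (R : realType) : set 'M[R]_3 :=
  [set Phi | joint Phi (unit_effect R) (unit_effect R) = 1 /\
    forall i j : 'I_5, 0 <= joint Phi (ray_effect R i) (ray_effect R j)].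
Arguments max_tensor R : clear implicits.

Definition product_states (R : realType) : set 'M[R]_3 :=
  [set Phi | exists i j : 'I_5, Phi = omega R i *m (omega R j)^T].
Arguments product_states R : clear implicits.

Definition entangled_points (R : realType) : set 'M[R]_3 :=
  extreme_points (max_tensor R) `\` product_states R.
Arguments entangled_points R : clear implicits.

(* T_(k+1)^s; the boolean s encodes the sign (-1)^s. *)
Definition rev_transf (R : realType) (k : 'I_5) (s : bool) : 'M[R]_3 :=
  let c := cos (angle5 R k) in let d := sin (angle5 R k) in
  mx3 c (- ((-1) ^+ s * d)) 0
      d ((-1) ^+ s * c)     0
      0 0                   1.

Definition local_equiv (R : realType) (Phi Psi : 'M[R]_3) : Prop :=
  exists (k1 k2 : 'I_5) (s1 s2 : bool),
    Psi = rev_transf R k1 s1 *m Phi *m (rev_transf R k2 s2)^T.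

Definition entangled_classes (R : realType) : set (set 'M[R]_3) :=
  [set [set Psi | entangled_points R Psi /\ local_equiv Phi Psi]
     | Phi in entangled_points R].
Arguments entangled_classes R : clear implicits.

Definition Phi_J (R : realType) : 'M[R]_3 := 1%:M.

Definition Phi_H (R : realType) : 'M[R]_3 :=
  let x := - r5 R ^+ 6 * sin (pi / 5) / (8 * (1 + r5 R ^+ 2)) in
  let y := - r5 R ^+ 3 / (4 * sin (pi / 5)) in
  mx3 (- cos (pi / 5)) x              0
      x                (cos (pi / 5)) y
      0                y              1.

(* Main.v *)
Require Import Defs.
From mathcomp Require Import all_boot all_order all_algebra.
From mathcomp Require Import all_classical all_reals all_analysis.
From mathcomp Require Import ring lra zify.
Set Implicit Arguments.
Unset Strict Implicit.
Unset Printing Implicit Defensive.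
Import Order.TTheory GRing.Theory Num.Theory.
Local Open Scope classical_set_scope.
Local Open Scope card_scope.
Local Open Scope ring_scope.

(* Up to positive factors, the constraints on a state Phi are the nonnegativity of the
   5 x 5 table x i j = eps_i^T Phi eps_j, where eps_n = (r cos (2 pi n / 5),
   r sin (2 pi n / 5), 1). With g = 2 cos (pi / 5) the golden ratio, the tables are cut
   out by x i (j + 3) = x i j + g (x i (j + 2) - x i (j + 1)), the same relation in i,
   and sum x = 25.

   For a polytope, a family of points F is exactly the set of extreme points as soon as
   the support (the set of nonzero constraints) of every point contains the support of
   some F v, and the supports of the F v form an antichain. So only zero patterns
   matter. Two kinds of facts suffice: two zeros at distance 2 in a line force the whole
   line to vanish, and three zero patterns, taken up to the dihedral symmetries, are
   impossible, each by one linear identity. A finite search using only these facts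
   shows that every support contains that of one of the 135 candidates. *)

(** * Polyhedra and supports *)

Section Polyhedron.

Variables (R : realType) (V : lmodType R) (K : finType).
Variables (h : V -> R) (L : K -> V -> R) (a : R).

Definition affine_form (f : V -> R) := forall (t : R) (p q : V),
  f (t *: p + (1 - t) *: q) = t * f p + (1 - t) * f q.

Hypothesis h_affine : affine_form h.
Hypothesis L_affine : forall k, affine_form (L k).
Hypothesis L_separates : forall p q, (forall k, L k p = L k q) -> p = q.
Hypothesis L_total : forall p, \sum_k L k p = a * h p.
Hypothesis a_gt0 : 0 < a.

Let P := [set p | h p = 1 /\ forall k, 0 <= L k p].

(** An index with [c k > 0] has [b k > 0] and allows any step up to [b k / c k]; finitely many such
    bounds have a positive minimum. *)
Lemma small_step (b c : K -> R) : (forall k, 0 <= b k) ->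
  (forall k, b k = 0 -> c k <= 0) ->
  exists2 e : R, 0 < e & forall k, e * c k <= b k.
Proof.
move=> b_ge0 bc.
suff [e e_gt0 eP] : exists2 e : R, 0 < e & forall k, k \in enum K -> e * c k <= b k.
  by exists e => // k; apply: eP; rewrite mem_enum.
elim: (enum K) => [|k s [e e_gt0 IHs]]; first by exists 1.
have [d d_gt0 dk] : exists2 d : R, 0 < d & d * c k <= b k.
  have [ck|ck] := lerP (c k) 0.
    by exists 1; rewrite ?mul1r ?(le_trans ck).
  have bk : 0 < b k.
    rewrite lt_neqAle b_ge0 andbT eq_sym; apply/eqP => /bc.
    by rewrite leNgt ck.
  by exists (b k / c k); rewrite ?divr_gt0 // divfK ?gt_eqF.
exists (Num.min d e); first by rewrite lt_min d_gt0.
move=> j; rewrite inE => /predU1P[->|/IHs ej].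
  have [ck|ck] := lerP (c k) 0.
    by apply: le_trans (b_ge0 k); rewrite mulr_ge0_le0 // le_min !ltW.
  by apply: le_trans dk; rewrite ler_pM2r // ge_min lexx.
have [cj|cj] := lerP (c j) 0.
  by apply: le_trans (b_ge0 j); rewrite mulr_ge0_le0 // le_min !ltW.
by apply: le_trans ej; rewrite ler_pM2r // ge_min lexx orbT.
Qed.

(** The inclusion of supports leaves room to move from [p] slightly further away from [v] inside
    [P]; extremality of [p] then forces [p = v]. *)
Lemma extreme_eq p v : extreme_points P p -> P v ->
  (forall k, L k v != 0 -> L k p != 0) -> p = v.
Proof.
move=> [[hp Lp] ext] [hv Lv] sub.
have [k Lpk0|e e_gt0 eP] := @small_step (L ^~ p) (fun k => L k v - L k p) Lp.
  have /eqP Lvk0 : L k v == 0 by apply/contraT => /sub; rewrite Lpk0 eqxx.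
  by rewrite Lvk0 Lpk0 subrr.
(* This is [p + e (p - v)]; the choice of [e] says exactly that every [L k q] stays nonnegative. *)
pose q := (1 + e) *: p + (1 - (1 + e)) *: v.
have e1_gt0 : 0 < 1 + e by rewrite addr_gt0.
have Pq : P q.
  split=> [|k]; first by rewrite h_affine hp hv !mulr1 addrC subrK.
  by rewrite L_affine; have := eP k; lra.
case: (ext q v (1 + e)^-1 Pq) => //.
  by rewrite invr_gt0 e1_gt0 invf_lt1 ?ltrDl.
rewrite /q scalerDr !scalerA mulVf ?gt_eqF // scale1r -addrA -scalerDl.
rewrite [X in X *: v](_ : _ = 0) ?scale0r ?addr0 //.
by field; rewrite gt_eqF.
Qed.

(* If [y] differed from [v], the ray from [v] through [y] would leave [P] at a point
   with a smaller support. *)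
Lemma minimal_support_uniq v y : P v -> P y ->
  (forall k, L k y != 0 -> L k v != 0) ->
  (forall q, P q -> (forall k, L k q != 0 -> L k v != 0) ->
    forall k, L k v != 0 -> L k q != 0) ->
  y = v.
Proof.
move=> Pv Py sub min; have [hv Lv] := Pv; have [hy Ly] := Py.
have sum_vy : \sum_k L k v = \sum_k L k y by rewrite !L_total hv hy.
have [k0 k0v] : exists k, L k v != 0.
  apply: contrapT => /forallNP v0; have := a_gt0.
  rewrite -[a]mulr1 -hv -L_total big1 ?ltxx // => k _.
  exact/eqP/negPn/negP/v0.
case: (Order.TotalTheory.arg_minP (P := fun k => L k v != 0)
  (fun k => L k y / L k v) k0v) => k kv kmin.
(* The largest factor for which [t * L j v <= L j y] for all [j]. *)
set t := L k y / L k v in kmin.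
have Lv_gt0 j : L j v != 0 -> 0 < L j v by move=> jv; rewrite lt_neqAle eq_sym jv Lv.
have ty j : t * L j v <= L j y.
  have [->|jv] := eqVneq (L j v) 0; first by rewrite mulr0.
  by have := kmin j jv; rewrite ler_pdivlMr ?Lv_gt0.
(* If [1 <= t], the differences [L i y - L i v] are nonnegative and sum to 0, so all vanish. *)
have [t1|t1] := lerP 1 t.
  apply: L_separates => j; apply/eqP; rewrite -subr_eq0.
  have d_ge0 i : true -> 0 <= L i y - L i v.
    move=> _; rewrite subr_ge0; apply: le_trans (ty i).
    by rewrite ler_peMl.
  have /eqP : \sum_i (L i y - L i v) = 0 by rewrite sumrB sum_vy subrr.
  by rewrite psumr_eq0 // => /allP/(_ j); rewrite mem_index_enum; apply.
have t1_gt0 : 0 < 1 - t by rewrite subr_gt0.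
pose q := (1 - t)^-1 *: y + (1 - (1 - t)^-1) *: v.
have Lq j : L j q = (1 - t)^-1 * (L j y - t * L j v).
  by rewrite L_affine; field; rewrite gt_eqF.
have Pq : P q.
  split=> [|j]; first by rewrite h_affine hv hy !mulr1 addrC subrK.
  by rewrite Lq mulr_ge0 ?subr_ge0 // invr_ge0 subr_ge0 ltW.
have subq j : L j q != 0 -> L j v != 0.
  apply: contraNN => /eqP jv0.
  have /eqP jy0 : L j y == 0 by apply: contraT => /sub; rewrite jv0 eqxx.
  by rewrite Lq jv0 jy0 mulr0 subrr mulr0.
have /eqP[] := min q Pq subq k kv.
by rewrite Lq divfK // subrr mulr0.
Qed.

(** Nonnegative values with positive weights cannot cancel, so both ends of a segment through [v]
    have their supports inside that of [v]. *)
Lemma minimal_support_extreme v : P v ->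
  (forall q, P q -> (forall k, L k q != 0 -> L k v != 0) ->
    forall k, L k v != 0 -> L k q != 0) ->
  extreme_points P v.
Proof.
move=> Pv min; split=> // y z t Py Pz /andP[t0 t1] vE.
have [[_ Ly] [_ Lz]] := (Py, Pz).
have t1' : 0 < 1 - t by rewrite subr_gt0.
have Lvk k : L k v = t * L k y + (1 - t) * L k z by rewrite vE L_affine.
split; apply: minimal_support_uniq => // k; rewrite Lvk.
  move=> ky; rewrite gt_eqF //; apply: ltr_pwDl; last exact: mulr_ge0 (ltW t1') _.
  by rewrite mulr_gt0 // lt_neqAle eq_sym ky Ly.
move=> kz; rewrite gt_eqF //; apply: ltr_wpDl; first exact: mulr_ge0 (ltW t0) _.
by rewrite mulr_gt0 // lt_neqAle eq_sym kz Lz.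
Qed.

Variables (I : Type) (F : I -> V).
Hypothesis PF : forall i, P (F i).
Hypothesis F_dominated : forall p, P p ->
  exists i, forall k, L k (F i) != 0 -> L k p != 0.
Hypothesis F_antichain : forall i j,
  (forall k, L k (F i) != 0 -> L k (F j) != 0) -> i = j.

(** The antichain condition makes the support of each [F i] minimal: a point below [F i] lies above
    some [F j], and then [j = i]. *)
Lemma extreme_points_polyhedron : extreme_points P = range F.
Proof.
apply/seteqP; split=> [p ext|_ [i _ <-]].
  have [i sub] := F_dominated ext.1.
  by exists i => //; apply/esym/extreme_eq.
apply: minimal_support_extreme => // q Pq sub k.
have [j subj] := F_dominated Pq.
rewrite -(F_antichain (fun k jk => sub k (subj k jk))); exact: subj.
Qed.

End Polyhedron.

(** * Search on zero patterns *)

Section Search.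

Notation pos := (nat * nat)%type.
Notation grid := (seq bitseq).

Definition marked (S : grid) (c : pos) : bool := nth false (nth [::] S c.1) c.2.

Definition mark (S : grid) (c : pos) : grid :=
  set_nth [::] S c.1 (set_nth false (nth [::] S c.1) c.2 true).

Lemma markedE S c d : marked (mark S c) d = (d == c) || marked S d.
Proof.
rewrite /marked /mark nth_set_nth /= -pair_eqE /=; case: eqP => //= ->.
by rewrite nth_set_nth /=; case: eqP.
Qed.

Variables (rules : seq (seq pos * seq pos)) (blocked supps : seq (seq pos)).

Definition fire (S : grid) (r : seq pos * seq pos) : grid :=
  if all (marked S) r.1 then foldl mark S r.2 else S.

(* Two passes need not reach the closure, but they suffice for the search to succeed. *)
Definition saturate (S : grid) : grid := iter 2 (fun S => foldl fire S rules) S.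

(* [S] holds cells known to be zero, [N] cells known to be nonzero. The search branches
   on the first zero cell [c] of the support [v]; the cells before it go to [N]. *)
Fixpoint branch (rec : grid -> seq pos -> bool) (S : grid) (N v : seq pos) :=
  if v is c :: v' then rec (mark S c) N && branch rec S (c :: N) v' else true.

(** A path closes when a cell of [N] is forced to be zero or a blocked pattern is marked. Otherwise
    a support free of marked cells is tried: either it has no zero, which is the goal, or one of its
    cells is zero. The fuel [n] bounds the depth. *)
Fixpoint covers (n : nat) (S : grid) (N : seq pos) : bool :=
  if has (marked S) N then true else
  if n is n'.+1 then
    let S := saturate S in
    if has (marked S) N || has (all (marked S)) blocked then true else
    if ohead [seq v <- supps | ~~ has (marked S) v] is Some v
    then branch (covers n') S N v else false
  else false.

Variable z : pred pos.
Hypothesis rulesP : forall r, r \in rules -> all z r.1 -> all z r.2.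
Hypothesis blockedP : forall A, A \in blocked -> ~~ all z A.

Let below S := forall c, marked S c -> z c.

Lemma below_mark S c : below S -> z c -> below (mark S c).
Proof. by move=> Sz zc d; rewrite markedE => /predU1P[->//|/Sz]. Qed.

Lemma below_marks S s : below S -> all z s -> below (foldl mark S s).
Proof.
elim: s S => //= c s IHs S Sz /andP[zc zs].
exact/IHs/zs/below_mark.
Qed.

Lemma below_fires rs S : {subset rs <= rules} -> below S -> below (foldl fire S rs).
Proof.
elim: rs S => //= r rs IHrs S sub Sz; apply: IHrs => [r' r'rs|].
  by apply: sub; rewrite inE r'rs orbT.
rewrite /fire; case: ifP => // /allP Sr; apply: below_marks => //.
by apply: rulesP; [rewrite sub ?mem_head|apply/allP => c /Sr/Sz].
Qed.

Lemma below_saturate S : below S -> below (saturate S).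
Proof. by move=> Sz; rewrite /saturate /=; do 2 apply: below_fires => //. Qed.

Lemma below_hits S N : below S -> {in N, forall c, ~~ z c} -> has (marked S) N = false.
Proof. by move=> Sz Nz; apply/hasP => -[c cN /Sz]; apply/negP/Nz. Qed.

(** The true zero set [z] selects one path of the search, on which [S] stays inside the zeros and
    [N] outside. Such a path cannot close by contradiction, so it ends at a support without
    zeros. *)
Lemma coversP n S N : covers n S N -> below S -> {in N, forall c, ~~ z c} ->
  exists2 v, v \in supps & {in v, forall c, ~~ z c}.
Proof.
elim: n S N => [|n IHn] S N /=.
  by case: ifP => // SN _ Sz Nz; rewrite (below_hits Sz Nz) in SN.
case: ifP => [SN _ Sz Nz|_ + /below_saturate Sz Nz].
  by rewrite (below_hits Sz Nz) in SN.
move: (saturate S) Sz => {}S Sz; rewrite (below_hits Sz Nz) /=.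
case: ifP => [/hasP[A Ab /allP AS] _|_].
  by case/negP: (blockedP Ab); apply/allP => c /AS/Sz.
case E: (ohead _) => [v|//].
have vs : v \in supps.
  suff : v \in [seq w <- supps | ~~ has (marked S) w].
    by rewrite mem_filter => /andP[].
  by case: [seq w <- supps | _] E => //= w s [->]; rewrite mem_head.
have [/allP vz _|] := boolP (all (predC z) v); first by exists v.
move=> + bS; elim: v N Nz bS {E vs} => //= c v IHv N Nz /andP[cov bS].
rewrite negb_and negbK; case/boolP: (z c) => [zc _|zc /= vz].
  exact: IHn cov (below_mark Sz zc) Nz.
by apply: IHv bS vz => d; rewrite inE => /predU1P[->|/Nz].
Qed.

End Search.

(** * Tables over the golden ratio *)

Section GoldenTables.

Variables (R : realFieldType) (g : R).
Hypothesis g_gt0 : 0 < g.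
Hypothesis g2 : g ^+ 2 = g + 1.

(** Multiplying the negation of a bound by [g] and replacing [g ^+ 2] by [g + 1] gives a
    contradiction. *)
Lemma golden_bounds : 3 / 2 < g < 5 / 3.
Proof.
have := g2; rewrite expr2 => gg; apply/andP; split; rewrite ltNge; apply/negP => c.
  by have := mulr_ge0 (ltW g_gt0) (etrans (subr_ge0 _ _) c); lra.
by have := mulr_ge0 (ltW g_gt0) (etrans (subr_ge0 _ _) c); lra.
Qed.

(** The characteristic polynomial is [(X - 1) (X^2 - (g - 1) X + 1)]. For [g = 2 cos (pi / 5)] its
    roots are 1 and [exp (± 2 pi i / 5)]: these sequences are the values of affine functions at
    successive vertices of a regular pentagon. *)
Definition golden_seq (u : nat -> R) :=
  forall n, u n.+3 = u n + g * (u n.+2 - u n.+1).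

Lemma golden_per u : golden_seq u -> forall n, u (n + 5)%N = u n.
Proof.
move=> uP n; rewrite !addnS addn0 !uP; ring: g2.
Qed.

Lemma golden_modn u : golden_seq u -> forall n, u (n %% 5)%N = u n.
Proof.
move=> uP n; rewrite [in RHS](divn_eq n 5) addnC.
elim: (n %/ 5)%N => [|q IHq]; first by rewrite addn0.
by rewrite mulSn addnCA addnC golden_per.
Qed.

Lemma golden_shift u a : golden_seq u -> golden_seq (fun n => u (n + a)%N).
Proof. by move=> uP n; rewrite !addSn uP. Qed.

(** Modulo 5, [4 * n] is [- n], and the recurrence reads the same backwards. *)
Lemma golden_flip u : golden_seq u -> golden_seq (fun n => u (4 * n)%N).
Proof.
move=> uP n; have per := golden_per uP.
have -> : (4 * n.+3 = (4 * n).+2 + 5 + 5)%N by lia.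
have -> : (4 * n.+2 = (4 * n).+3 + 5)%N by lia.
have -> : (4 * n.+1 = (4 * n).+4)%N by lia.
by rewrite !per !uP; ring: g2.
Qed.

Lemma golden_sum_shift u a : golden_seq u ->
  \sum_(n < 5) u (n + a)%N = \sum_(n < 5) u n.
Proof.
move=> uP; elim: a => [|a IHa]; first by under eq_bigr do rewrite addn0.
rewrite -{}IHa !big_ord_recr !big_ord0 /=.
have -> : (4 + a.+1 = a + 5)%N by lia.
by rewrite golden_per // !addnS !addSn !add0n; ring.
Qed.

Lemma golden_sum_flip u : golden_seq u ->
  \sum_(n < 5) u (4 * n)%N = \sum_(n < 5) u n.
Proof.
move=> uP; under eq_bigr do rewrite -(golden_modn uP).
by rewrite !(big_ord_recl, big_ord0) /= /bump /=; ring.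
Qed.

(** The recurrence gives [u n.+3 = - g * u n.+1] with both sides nonnegative, so both vanish; three
    consecutive zeros then propagate. *)
Lemma golden_line0 u : golden_seq u -> (forall n, 0 <= u n) ->
  forall n, u n = 0 -> u n.+2 = 0 -> forall m, u m = 0.
Proof.
move=> uP u_ge0 n u0 u2.
have := u_ge0 n.+1; have := u_ge0 n.+3.
rewrite uP u0 u2 add0r sub0r mulrN oppr_ge0 pmulr_rle0 // => u1 u1'.
have {u1'} {}u1 : u n.+1 = 0 by apply/eqP; rewrite eq_le u1.
have vP := golden_shift n uP.
have v0 k : u (k + n)%N = 0.
  rewrite -(golden_modn vP); have : (k %% 5 < 5)%N by rewrite ltn_mod.
  by case: (k %% 5)%N => [|[|[|[|[|]]]]] //= _; rewrite ?(addSn, add0n) ?uP ?u0 ?u1 ?u2; ring.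
move=> m; rewrite -(golden_modn uP) -(modnMDl n m 5) (golden_modn uP).
by have -> : (n * 5 + m = (4 * n + m) + n)%N by lia.
Qed.

Definition golden_table (x : nat -> nat -> R) :=
  [/\ forall i j, 0 <= x i j, forall i, golden_seq (x i),
      forall j, golden_seq (x^~ j) & \sum_(i < 5) \sum_(j < 5) x i j = 25].

Lemma golden_table_move x a b e : e \in [:: 1%N; 4%N] -> golden_table x ->
  golden_table (fun i j => x (i + a)%N (e * j + b)%N).
Proof.
move=> e14 [x_ge0 rowP colP xS].
have eP u : golden_seq u -> golden_seq (fun n => u (e * n)%N).
  move=> uP n; move: e14; rewrite !inE => /orP[]/eqP->.
    by rewrite !mul1n.
  exact: golden_flip.
have eS u : golden_seq u -> \sum_(n < 5) u (e * n)%N = \sum_(n < 5) u n.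
  move=> uP; move: e14; rewrite !inE => /orP[]/eqP->.
    by under eq_bigr do rewrite mul1n.
  exact: golden_sum_flip.
split=> [i j|i|j|] //; first exact/(eP (fun n => x _ (n + b)%N))/golden_shift.
  exact: (golden_shift (u := x^~ _)).
rewrite -xS -(golden_sum_shift (u := fun i => \sum_(j < 5) x i j) a) => [|i].
  apply: eq_bigr => i _; rewrite -(golden_sum_shift b) //.
  by rewrite (eS (fun n => x _ (n + b)%N)) //; exact: golden_shift.
rewrite -sumrB mulr_sumr -big_split; apply: eq_bigr => j _; exact: colP.
Qed.

(* The impossible zero patterns; their images under rotations and reflections of the two
   pentagons are impossible too. *)
Definition base_blocked : seq (seq (nat * nat)) :=
  [:: [:: (0, 0); (1, 1); (2, 4); (4, 2)];
      [:: (0, 0); (1, 1); (2, 3); (3, 4); (4, 2)];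
      [:: (0, 0); (1, 2); (2, 4); (3, 1); (4, 3)]]%N.

(** On a table vanishing on the pattern, the matching identity would write 25 as a nonpositive
    number. *)
Lemma base_blockedP x A : golden_table x -> A \in base_blocked ->
  ~~ all (fun c => x c.1 c.2 == 0) A.
Proof.
move=> [x_ge0 rowP colP xS] Abase; apply/negP.
have x3 i : x i 3%N = x i 0%N + g * (x i 2%N - x i 1%N) by rewrite rowP.
have x4 i : x i 4%N = x i 1%N + g * (x i 3%N - x i 2%N) by rewrite rowP.
have y3 j : x 3%N j = x 0%N j + g * (x 2%N j - x 1%N j) by rewrite colP.
have y4 j : x 4%N j = x 1%N j + g * (x 3%N j - x 2%N j) by rewrite colP.
(* Linear programming certificates: the cells with a positive coefficient are those of
   the pattern. *)
have [EA EB EC] : [/\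
  25 = 5 * ((g + 2) * (x 0%N 0%N + x 1%N 1%N) + (g + 1) * (x 2%N 4%N + x 4%N 2%N)
            - 2 * g * (x 0%N 1%N + x 1%N 0%N) - x 3%N 3%N),
  25 = 5 * (g * (x 0%N 0%N + x 1%N 1%N) + 2 * (x 2%N 3%N + x 3%N 4%N) + (g + 1) * x 4%N 2%N
            - 2 * x 0%N 1%N - (g - 1) * x 2%N 4%N - (2 * g - 1) * x 3%N 3%N) &
  (* The cells [(i, 2 i mod 5)] carry one fifth of the total in every table. *)
  25 = 5 * (x 0%N 0%N + x 1%N 2%N + x 2%N 4%N + x 3%N 1%N + x 4%N 3%N)].
  rewrite -xS !big_ord_recr !big_ord0 /=.
  by split; rewrite !(x4, x3, y4, y3); ring: g2.
have [[[x01 x10] x33] x24] := (x_ge0 0%N 1%N, x_ge0 1%N 0%N, x_ge0 3%N 3%N, x_ge0 2%N 4%N).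
move: Abase; rewrite !inE => /or3P[]/eqP-> /=.
- move=> /and5P[/eqP e1 /eqP e2 /eqP e3 /eqP e4 _].
  have := mulr_ge0 (ltW g_gt0) (addr_ge0 x01 x10).
  by move: EA; rewrite e1 e2 e3 e4; lra.
- move=> /and5P[/eqP e1 /eqP e2 /eqP e3 /eqP e4 /andP[/eqP e5 _]].
  have /andP[g_gt _] := golden_bounds; have g1 : 0 <= g - 1 by lra.
  have g1' : 0 <= 2 * g - 1 by lra.
  have := mulr_ge0 g1 x24; have := mulr_ge0 g1' x33.
  by move: EB; rewrite e1 e2 e3 e4 e5; lra.
move=> /and5P[/eqP e1 /eqP e2 /eqP e3 /eqP e4 /andP[/eqP e5 _]].
by move: EC; rewrite e1 e2 e3 e4 e5; lra.
Qed.


End GoldenTables.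

(** * The 135 zero patterns *)

Local Notation cell := (nat * nat)%type.

Definition cells : seq cell := [seq (i, j) | i <- iota 0 5, j <- iota 0 5].

Definition row_rules : seq (seq cell * seq cell) :=
  [seq ([:: c; (c.1, (c.2 + 2) %% 5)], [seq (c.1, k) | k <- iota 0 5]) | c <- cells]%N.

Definition swap (c : cell) : cell := (c.2, c.1).

Definition line_rules : seq (seq cell * seq cell) :=
  row_rules ++ [seq (map swap r.1, map swap r.2) | r <- row_rules].

Definition move_cell (s : cell * nat) (c : cell) : cell :=
  ((c.1 + s.1.1) %% 5, (s.2 * c.2 + s.1.2) %% 5)%N.

(** Both pentagons are rotated and the second may be reflected, as in [golden_table_move]. *)
Definition blocked : seq (seq cell) :=
  [seq map (move_cell s) A | A <- base_blocked, s <- [seq (c, e) | c <- cells, e <- [:: 1; 4]]]%N.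

(* The ordinal [k] stands for [k + 1], as in [angle5]. *)
Definition rot5 (a : 'I_5 * bool) (n : nat) : nat :=
  (if a.2 then a.1.+1 + 4 * n else n + 4 * a.1.+1)%N.

(** The summands index the 25 product states, the 10 images of [Phi_J] and the 100 images of
    [Phi_H]. *)
Local Notation label :=
  ('I_5 * 'I_5 + 'I_5 * bool + ('I_5 * bool) * ('I_5 * bool))%type.

(** Two vertices are orthogonal exactly when their indices differ by 2 or 3 modulo 5. *)
Definition zeroJ (n : nat) : bool := (n %% 5 == 2)%N || (n %% 5 == 3)%N.

(** Row by row, the columns where the table of [Phi_H] vanishes. *)
Definition zerosH : seq (seq nat) :=
  [:: [:: 0; 1]; [:: 0; 4]; [:: 2; 3]; [:: 2]; [:: 1]]%N.

Definition zeroH (i j : nat) : bool := (j %% 5)%N \in nth [::] zerosH (i %% 5).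

Definition vanish (v : label) (c : cell) : bool :=
  match v with
  | inl (inl (k, l)) => zeroJ (c.1 + 4 * k.+1) || zeroJ (c.2 + 4 * l.+1)
  | inl (inr a) => zeroJ (rot5 a c.1 + 4 * c.2)
  | inr (a, b) => zeroH (rot5 a c.1) (rot5 b c.2)
  end.

Definition supp (v : label) : seq cell := [seq c <- cells | ~~ vanish v c].

(** Written out so that [labels] can be evaluated. *)
Definition ords5 : seq 'I_5 := [:: @Ordinal 5 0 isT; @Ordinal 5 1 isT;
  @Ordinal 5 2 isT; @Ordinal 5 3 isT; @Ordinal 5 4 isT].

Lemma mem_ords5 k : k \in ords5.
Proof. by case: k => -[|[|[|[|[|]]]]]. Qed.

Definition dihedral5 : seq ('I_5 * bool) :=
  [seq (k, s) | k <- ords5, s <- [:: false; true]].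

Lemma mem_dihedral5 a : a \in dihedral5.
Proof. by case: a => k s; rewrite allpairs_f ?mem_ords5 //; case: s. Qed.

Definition labels : seq label :=
  [seq inl (inl p) | p <- [seq (k, l) | k <- ords5, l <- ords5]] ++
  [seq inl (inr a) | a <- dihedral5] ++
  [seq inr p | p <- [seq (a, b) | a <- dihedral5, b <- dihedral5]].

Lemma mem_labels v : v \in labels.
Proof.
rewrite !mem_cat; case: v => [[[k l]|a]|[a b]]; apply/or3P.
- by constructor 1; apply/map_f/allpairs_f; exact: mem_ords5.
- by constructor 2; apply: (map_f (fun a => inl (inr a))); exact: mem_dihedral5.
by constructor 3; apply/map_f/allpairs_f; exact: mem_dihedral5.
Qed.

(** Each branching marks a new one of the 25 cells, so fuel 26 cannot run out. *)
Lemma covers_supp : covers line_rules blocked (map supp labels) 26 [::] [::].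
Proof. by vm_compute. Qed.

(** A check of all pairs of labels; it yields both the antichain condition and the injectivity of
    [state]. *)
Lemma supp_antichain v w : {in supp v, forall c, ~~ vanish w c} -> v = w.
Proof.
have : all (fun v => all (fun w =>
    all (predC (vanish w)) (supp v) ==> (v == w)) labels) labels.
  by vm_compute.
move=> /allP/(_ v (mem_labels v))/allP/(_ w (mem_labels w))/implyP vw vw0.
exact/eqP/vw/allP.
Qed.

Lemma golden_table_supp (R : realFieldType) (g : R) x : 0 < g -> g ^+ 2 = g + 1 ->
  golden_table g x -> exists v, {in supp v, forall c, x c.1 c.2 != 0}.
Proof.
move=> g_gt0 g2 xP; have [x_ge0 rowP colP xS] := xP.
have modx i j : x (i %% 5)%N (j %% 5)%N = x i j.
  by rewrite (golden_modn g2 (rowP _)) (golden_modn g2 (colP _)).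
pose z (c : cell) := x c.1 c.2 == 0.
have rulesP r : r \in line_rules -> all z r.1 -> all z r.2.
  rewrite /line_rules /row_rules; move: (iota 0 5) => ks.
  rewrite mem_cat => /orP[]/mapP[c]; last first.
    move=> /mapP[{}c _ ->] -> /= /and3P[/eqP c0 /eqP c2 _].
    apply/allP => _ /mapP[_ /mapP[k _ ->] ->] /=; apply/eqP.
    apply: (golden_line0 g_gt0 g2 (colP c.1) _ c0) => //.
    by rewrite -c2 -modx -[RHS]modx modn_mod addn2.
  move=> _ -> /= /and3P[/eqP c0 /eqP c2 _].
  apply/allP => _ /mapP[k _ ->] /=; apply/eqP.
  apply: (golden_line0 g_gt0 g2 (rowP c.1) _ c0) => //.
  by rewrite -c2 -modx -[RHS]modx modn_mod addn2.
(* A zero pattern moved by [s] in [x] is the base pattern in the table moved by [s]. *)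
have blockedP A : A \in blocked -> ~~ all z A.
  case/allpairsP => -[B s] [Bbase /allpairsP[[c e] [_ e14 sE]] ->].
  rewrite /= in Bbase e14 sE; rewrite {}sE.
  have := base_blockedP g_gt0 g2 (golden_table_move g_gt0 g2 c.1 c.2 e14 xP) Bbase.
  by apply: contraNN; rewrite all_map; apply: sub_all => d; rewrite /z /= modx.
have [c||_ /mapP[v _ ->] vx] := coversP rulesP blockedP covers_supp.
- by rewrite /marked !nth_nil.
- by [].
by exists v.
Qed.

(** * The pentagon *)

Section PentagonGeometry.

Variable R : realType.
Definition golden : R := 2 * cos (pi / 5).

Local Notation c := (cos (pi / 5) : R).
Local Notation s := (sin (pi / 5) : R).
Local Notation g := golden.
Local Notation r := (r5 R).

Lemma cos_pi5 : c = g / 2.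
Proof. by rewrite /g; lra. Qed.

Lemma golden_gt0 : 0 < g.
Proof.
have pi0 := pi_gt0 R; rewrite mulr_gt0 // cos_gt0_pihalf //; apply/andP; split; lra.
Qed.

Lemma sin_pi5_gt0 : 0 < s.
Proof. by have pi0 := pi_gt0 R; rewrite sin_gt0_pihalf //; apply/andP; split; lra. Qed.

(* [cos 3t = - cos 2t] for [t = pi / 5]. *)
Lemma golden_eq : g ^+ 2 = g + 1.
Proof.
have : cos (pi / 5 *+ 2 + pi / 5) = - cos (pi / 5 *+ 2) :> R.
  rewrite -(cosN (pi / 5 *+ 2)) -cosDpi; congr cos; rewrite -mulr_natl; lra.
rewrite cosD sin_mulr2n cos_mulr2n !mulr2n => cD.
have c0 : c + 1 != 0 by rewrite gt_eqF //; have := golden_gt0; rewrite /golden; lra.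
have s2 := sin2cos2 (pi / 5 : R).
(* With [c = cos t], [cos 3t + cos 2t = (c + 1) (4 c^2 - 2 c - 1)], and the last factor is
   [g ^+ 2 - g - 1]. *)
apply/eqP; rewrite -subr_eq0 -(inj_eq (mulfI c0)) mulr0; apply/eqP.
transitivity ((2 * c ^+ 2 - 1) * c - 2 * (c * s) * s + (2 * c ^+ 2 - 1)).
  by rewrite /golden; ring: s2.
by move: cD; lra.
Qed.

Lemma golden_cube : g ^+ 3 = 2 * g + 1.
Proof. by ring: golden_eq. Qed.

Lemma sin_pi5_sqr : s ^+ 2 = (3 - g) / 4.
Proof. by rewrite sin2cos2; have := golden_eq; rewrite cos_pi5; lra. Qed.

Lemma r5_gt0 : 0 < r.
Proof. by rewrite sqrtr_gt0 invr_gt0; have := golden_gt0; rewrite /golden; lra. Qed.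

Lemma r5_sqr : r ^+ 2 = 2 * (g - 1).
Proof.
have c0 : 0 < c by have := golden_gt0; rewrite /golden; lra.
rewrite sqr_sqrtr ?invr_ge0 ?ltW //.
by apply: (mulfI (lt0r_neq0 c0)); rewrite divff ?gt_eqF //; have := golden_eq; rewrite cos_pi5; lra.
Qed.

(** * Cosines and sines of the multiples of [2 pi / 5] *)

Definition cos5 (n : nat) : R := cos (2 * pi * n%:R / 5).
Definition sin5 (n : nat) : R := sin (2 * pi * n%:R / 5).

Lemma cos5D m n : cos5 (m + n) = cos5 m * cos5 n - sin5 m * sin5 n.
Proof. by rewrite -cosD /cos5 natrD; congr cos; field. Qed.

Lemma sin5D m n : sin5 (m + n) = sin5 m * cos5 n + cos5 m * sin5 n.
Proof. by rewrite -sinD /sin5 natrD; congr sin; field. Qed.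

Lemma cos5_0 : cos5 0 = 1.
Proof. by rewrite /cos5 mulr0 mul0r cos0. Qed.

Lemma sin5_0 : sin5 0 = 0.
Proof. by rewrite /sin5 mulr0 mul0r sin0. Qed.

Lemma cos5_1 : cos5 1 = (g - 1) / 2.
Proof.
have -> : cos5 1 = cos (pi / 5 *+ 2) by congr cos; rewrite -mulr_natl; field.
by rewrite cos_mulr2n cos_pi5 -mulr_natl; have := golden_eq; lra.
Qed.

Lemma sin5_1 : sin5 1 = g * s.
Proof.
have -> : sin5 1 = sin (pi / 5 *+ 2) by congr sin; rewrite -mulr_natl; field.
by rewrite sin_mulr2n cos_pi5 -mulr_natl; field.
Qed.

Lemma cos5_2 : cos5 2 = - g / 2.
Proof.
rewrite (cos5D 1 1) cos5_1 sin5_1 (mulrACA g) -!expr2 sin_pi5_sqr.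
by have := (golden_eq, golden_cube) => -[]; lra.
Qed.

Lemma sin5_2 : sin5 2 = s.
Proof. by rewrite (sin5D 1 1) cos5_1 sin5_1; field: golden_eq. Qed.

Lemma cos5_3 : cos5 3 = - g / 2.
Proof.
rewrite (cos5D 2 1) cos5_1 sin5_1 cos5_2 sin5_2 (mulrCA s) -expr2 sin_pi5_sqr.
by have := golden_eq; lra.
Qed.

Lemma sin5_3 : sin5 3 = - s.
Proof. by rewrite (sin5D 2 1) cos5_1 sin5_1 cos5_2 sin5_2; field: golden_eq. Qed.

Lemma cos5_4 : cos5 4 = (g - 1) / 2.
Proof.
by rewrite (cos5D 2 2) cos5_2 sin5_2 -!expr2 sin_pi5_sqr; have := golden_eq; lra.
Qed.

Lemma sin5_4 : sin5 4 = - (g * s).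
Proof. by rewrite (sin5D 2 2) cos5_2 sin5_2; field. Qed.

Definition trig5E := (cos5_0, cos5_1, cos5_2, cos5_3, cos5_4,
  sin5_0, sin5_1, sin5_2, sin5_3, sin5_4).

Lemma golden_cos5 : golden_seq g cos5.
Proof.
by move=> n; rewrite -(addn3 n) -(addn2 n) -(addn1 n) !cos5D !trig5E; field: golden_eq.
Qed.

Lemma golden_sin5 : golden_seq g sin5.
Proof.
by move=> n; rewrite -(addn3 n) -(addn2 n) -(addn1 n) !sin5D !trig5E; field: golden_eq.
Qed.

Lemma trig5N m : cos5 (4 * m) = cos5 m /\ sin5 (4 * m) = - sin5 m.
Proof.
have cosm := golden_modn golden_eq golden_cos5.
have sinm := golden_modn golden_eq golden_sin5.
rewrite -(cosm m) -(sinm m) -(cosm (4 * m)%N) -(sinm (4 * m)%N) -modnMmr.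
have : (m %% 5 < 5)%N by rewrite ltn_mod.
case: (m %% 5)%N => [|[|[|[|[|//]]]]] _;
  [set k := (_ %% 5)%N; rewrite -[k]/0%N|set k := (_ %% 5)%N; rewrite -[k]/4%N
  |set k := (_ %% 5)%N; rewrite -[k]/3%N|set k := (_ %% 5)%N; rewrite -[k]/2%N
  |set k := (_ %% 5)%N; rewrite -[k]/1%N];
  by rewrite !trig5E; split; ring.
Qed.

(** Modulo 5, [m + 4 * n] is [m - n], so this is the difference formula without truncated
    subtraction. *)
Lemma cos5B m n : cos5 (m + 4 * n) = cos5 m * cos5 n + sin5 m * sin5 n.
Proof. by have [cosN sinN] := trig5N n; rewrite cos5D cosN sinN; ring. Qed.

Lemma sin5B m n : sin5 (m + 4 * n) = sin5 m * cos5 n - cos5 m * sin5 n.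
Proof. by have [cosN sinN] := trig5N n; rewrite sin5D cosN sinN; ring. Qed.

Lemma vec3_eq (v w : 'cV[R]_3) :
  v 0 0 = w 0 0 -> v 1 0 = w 1 0 -> v 2%R 0 = w 2%R 0 -> v = w.
Proof.
move=> v0 v1 v2; apply/colP => -[[|[|[|//]]] i3].
- by rewrite (_ : Ordinal i3 = 0) //; apply: val_inj.
- by rewrite (_ : Ordinal i3 = 1) //; apply: val_inj.
by rewrite (_ : Ordinal i3 = 2%R) //; apply: val_inj.
Qed.

(** The same vector serves as a pure state and, up to scaling, as a ray-extremal effect. *)
Definition eps (n : nat) : 'cV[R]_3 := vec3 (r * cos5 n) (r * sin5 n) 1.

Lemma eps_golden n : eps n.+3 = eps n + g *: (eps n.+2 - eps n.+1).
Proof.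
by apply: vec3_eq; rewrite !mxE /= ?golden_cos5 ?golden_sin5; ring.
Qed.

Lemma omegaE (k : 'I_5) : omega R k = eps k.+1.
Proof. by []. Qed.

Lemma ray_effectE (k : 'I_5) : ray_effect R k = (1 + r ^+ 2)^-1 *: eps k.+1.
Proof. by []. Qed.

Lemma sum_eps : \sum_(n < 5) eps n = 5 *: unit_effect R.
Proof.
rewrite !big_ord_recr big_ord0 /= add0r.
by apply: vec3_eq; rewrite !mxE /= ?trig5E; field.
Qed.

(** The vertices 0, 1 and 4 form a basis: [E1 - E4] isolates row 1 of [A], then [E0 - E1] isolates
    row 0. *)
Lemma eps_sep m (A : 'M[R]_(3, m)) :
  (forall n, (n < 5)%N -> (eps n)^T *m A = 0) -> A = 0.
Proof.
move=> epsA; apply/matrixP => i j; rewrite mxE.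
have E n : (n < 5)%N -> r * cos5 n * A 0 j + r * sin5 n * A 1 j + A 2%R j = 0.
  move=> /epsA/matrixP/(_ 0 j); rewrite !mxE !big_ord_recl big_ord0 !mxE /=.
  rewrite mul1r addr0 addrA => <-.
  by congr (_ * A _ _ + _ * A _ _ + A _ _); apply: val_inj.
have := (E 0%N isT, E 1%N isT, E 4%N isT); rewrite !trig5E => -[[E0 E1] E4].
have r0 := r5_gt0; have g0 := golden_gt0; have s0 := sin_pi5_gt0.
have A1 : A 1 j = 0.
  have rgs := mulr_gt0 (mulr_gt0 r0 g0) s0.
  have : r * g * s * A 1 j = 0 by lra.
  by move/eqP; rewrite mulf_eq0 gt_eqF //= => /eqP.
have A0 : A 0 j = 0.
  have /andP[_ g_lt] := golden_bounds golden_gt0 golden_eq.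
  have rg : 0 < r * (3 - g) by rewrite mulr_gt0 //; lra.
  have : r * (3 - g) * A 0 j = 0 by lra.
  by move/eqP; rewrite mulf_eq0 gt_eqF //= => /eqP.
have A2 : A 2%R j = 0 by move: E0; rewrite A0 A1; lra.
case: i => -[|[|[|//]]] i3.
- by rewrite -A0; congr (A _ _); apply: val_inj.
- by rewrite -A1; congr (A _ _); apply: val_inj.
by rewrite -A2; congr (A _ _); apply: val_inj.
Qed.

Lemma eps_inj m (A B : 'M[R]_(3, m)) :
  (forall n, (n < 5)%N -> (eps n)^T *m A = (eps n)^T *m B) -> A = B.
Proof.
move=> AB; apply/eqP; rewrite -subr_eq0; apply/eqP/eps_sep => n n5.
by rewrite mulmxBr AB // subrr.
Qed.

(** * Tables of matrices on the vertices *)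

Definition table (Phi : 'M[R]_3) (i j : nat) : R := joint Phi (eps i) (eps j).

Lemma joint_affine e f : affine_form (fun Phi : 'M[R]_3 => joint Phi e f).
Proof.
move=> t p q; rewrite /joint mulmxDr mulmxDl -!scalemxAr -!scalemxAl.
by rewrite !mxE.
Qed.

Lemma table_inj Phi Psi : (forall i j : 'I_5, table Phi i j = table Psi i j) -> Phi = Psi.
Proof.
move=> PP; apply: eps_inj => i i5.
apply: trmx_inj; apply: eps_inj => j j5.
apply: trmx_inj; rewrite !trmx_mul !trmxK.
apply/matrixP => a b; rewrite !ord1.
exact: (PP (Ordinal i5) (Ordinal j5)).
Qed.

Lemma table_row Phi i : golden_seq g (table Phi i).
Proof.
move=> n; rewrite /table /joint eps_golden mulmxDr -scalemxAr mulmxBr.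
by rewrite !mxE.
Qed.

Lemma table_tr Phi i j : table Phi^T i j = table Phi j i.
Proof.
transitivity (((eps j)^T *m Phi *m eps i)^T 0 0); last by rewrite mxE.
by rewrite !trmx_mul trmxK mulmxA.
Qed.

Lemma table_col Phi j : golden_seq g ((table Phi)^~ j).
Proof. by move=> n; rewrite -!(table_tr Phi) table_row. Qed.

Lemma table_modn Phi i j : table Phi (i %% 5)%N (j %% 5)%N = table Phi i j.
Proof.
rewrite (golden_modn golden_eq (table_row _ _)).
exact: (golden_modn golden_eq (table_col _ _)).
Qed.

(** On each side the five vertices sum to 5 times the unit effect. *)
Lemma table_sum Phi : \sum_(i < 5) \sum_(j < 5) table Phi i j =
  25 * joint Phi (unit_effect R) (unit_effect R).
Proof.
have -> : \sum_(i < 5) \sum_(j < 5) table Phi i j =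
    joint Phi (\sum_(i < 5) eps i) (\sum_(j < 5) eps j).
  rewrite /joint [(\sum_(i < 5) eps i)^T]linear_sum !mulmx_suml summxE; apply: eq_bigr => i _.
  by rewrite mulmx_sumr summxE.
rewrite sum_eps /joint -scalemxAr [(5 *: _)^T]linearZ /= -!scalemxAl scalerA mxE.
by congr (_ * _); lra.
Qed.

End PentagonGeometry.

(** * Candidate vertices *)

Section Vertices.

Variable R : realType.
Local Notation s := (sin (pi / 5) : R).
Local Notation g := (golden R).
Local Notation r := (r5 R).

Definition transf (a : 'I_5 * bool) : 'M[R]_3 := rev_transf R a.1 a.2.

(** The transpose undoes a rotation by [k] and repeats a reflection: [n] becomes [n - k] or
    [k - n]. *)
Lemma transf_eps a n : (transf a)^T *m eps R n = eps R (rot5 a n).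
Proof.
have E m : (cos (angle5 R m) = cos5 R m.+1) * (sin (angle5 R m) = sin5 R m.+1) by [].
by case: a => k [];
  apply: vec3_eq; rewrite !mxE !big_ord_recl big_ord0 !mxE /= ?cos5B ?sin5B ?E; ring.
Qed.

Lemma transf_unit a : (transf a)^T *m unit_effect R = unit_effect R.
Proof.
by apply: vec3_eq; rewrite !mxE !big_ord_recl big_ord0 !mxE /=; ring.
Qed.

Lemma joint_move A B Phi e f : 
  joint (A *m Phi *m B^T) e f = joint Phi (A^T *m e) (B^T *m f) :> R.
Proof. by rewrite /joint trmx_mul trmxK !mulmxA. Qed.

Lemma table_transf a b Phi i j :
  table (transf a *m Phi *m (transf b)^T) i j = table Phi (rot5 a i) (rot5 b j).
Proof. by rewrite /table joint_move !transf_eps. Qed.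

Lemma joint_outer (v w e f : 'cV[R]_3) :
  joint (v *m w^T) e f = (e^T *m v) 0 0 * (f^T *m w) 0 0.
Proof.
rewrite /joint !mulmxA -mulmxA mxE big_ord1; congr (_ * _).
by rewrite -[w in RHS]trmxK -trmx_mul [RHS]mxE.
Qed.

Definition overlap (n : nat) : R := r ^+ 2 * cos5 R n + 1.

Lemma eps_dot i j : ((eps R i)^T *m eps R j) 0 0 = overlap (i + 4 * j).
Proof.
rewrite !mxE !big_ord_recl big_ord0 !mxE /= /overlap cos5B; ring.
Qed.

(** The values are [2 * g - 1] at 0, [3 - g] at 1 and 4, and 0 at 2 and 3, where
    [cos (4 pi / 5) = - 1 / r ^+ 2]. *)
Lemma overlapP n : (0 <= overlap n) * ((overlap n == 0) = zeroJ n).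
Proof.
rewrite /overlap -(golden_modn (golden_eq R) (golden_cos5 R)) r5_sqr /zeroJ.
have := golden_bounds (golden_gt0 R) (golden_eq R); have g2 := golden_eq R.
move=> /andP[g_gt g_lt]; have : (n %% 5 < 5)%N by rewrite ltn_mod.
case: (n %% 5)%N => [|[|[|[|[|//]]]]] _; rewrite trig5E /=.
- rewrite (_ : _ + 1 = 2 * g - 1); last by ring.
  by split; [lra|apply/negbTE/lt0r_neq0; lra].
- rewrite (_ : _ + 1 = 3 - g); last by field: g2.
  by split; [lra|apply/negbTE/lt0r_neq0; lra].
- by rewrite (_ : _ + 1 = 0) ?lexx ?eqxx //; field: g2.
- by rewrite (_ : _ + 1 = 0) ?lexx ?eqxx //; field: g2.
rewrite (_ : _ + 1 = 3 - g); last by field: g2.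
by split; [lra|apply/negbTE/lt0r_neq0; lra].
Qed.

(** Dividing the sines by [s] leaves [r] and [s] only in combinations that are polynomials in
    [g]. *)
Lemma table_H_golden i j u v : sin5 R i = s * u -> sin5 R j = s * v ->
  table (Phi_H R) i j = 1 - cos5 R i * cos5 R j
    + (8 - 5 * g) / 2 * (cos5 R i * v + u * cos5 R j)
    + (3 - g) / 4 * (u * v) + (g - 2) * (u + v).
Proof.
move=> iu jv; have g2 := golden_eq R; have g0 := golden_gt0 R.
have s0 : s != 0 by rewrite gt_eqF ?sin_pi5_gt0.
have /andP[g_gt _] := golden_bounds g0 g2.
have rr : 1 + r ^+ 2 = 2 * g - 1 by rewrite r5_sqr; ring.
have rr0 : 2 * g - 1 != 0 by apply: lt0r_neq0; lra.
pose x : R := - r ^+ 6 * s / (8 * (1 + r ^+ 2)).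
pose y : R := - r ^+ 3 / (4 * s).
have rx : r ^+ 2 * x * s = (8 - 5 * g) / 2.
  have -> : r ^+ 2 * x * s = - (r ^+ 2) ^+ 4 * s ^+ 2 / (8 * (1 + r ^+ 2)).
    by rewrite /x; field; rewrite rr.
  by rewrite sin_pi5_sqr rr r5_sqr; field: g2.
have ry : r * y * s = g - 2.
  have -> : r * y * s = - (r ^+ 2) ^+ 2 / 4 by rewrite /y; field.
  by rewrite r5_sqr; field: g2.
have rc : r ^+ 2 * (g / 2) = 1 by rewrite r5_sqr; field: g2.
transitivity (1 - r ^+ 2 * (g / 2) * (cos5 R i * cos5 R j)
    + r ^+ 2 * x * s * (cos5 R i * v + u * cos5 R j)
    + r ^+ 2 * (g / 2) * s ^+ 2 * (u * v) + r * y * s * (u + v)).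
  rewrite /table /joint !mxE !big_ord_recl !big_ord0 !mxE !big_ord_recl !big_ord0.
  by rewrite !mxE /= -/x -/y iu jv cos_pi5; move: (x) (y) => x1 y1; field.
by rewrite rx ry rc sin_pi5_sqr; ring.
Qed.

Definition valueH (i j : nat) : R := nth 0 (nth [::]
  [:: [:: 0; 0; 3 - g; 2 * g - 1; 3 - g];
      [:: 0; 7 - 4 * g; 3 * g - 4; 7 - 4 * g; 0];
      [:: 3 - g; 3 * g - 4; 0; 0; 3 * g - 4];
      [:: 2 * g - 1; 7 - 4 * g; 0; 3 - g; 6 - 2 * g];
      [:: 3 - g; 0; 3 * g - 4; 6 - 2 * g; 5 * g - 5]] i) j.

Lemma table_HE i j : (i < 5)%N -> (j < 5)%N -> table (Phi_H R) i j = valueH i j.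
Proof.
have sinE n : (n < 5)%N -> sin5 R n = s * [:: 0; g; 1; -1; - g]`_n.
  by case: n => [|[|[|[|[|//]]]]] _; rewrite trig5E /=; ring.
have g2 := golden_eq R => i5 j5; rewrite (table_H_golden (sinE _ i5) (sinE _ j5)).
by case: i j i5 j5 => [|[|[|[|[|//]]]]] [|[|[|[|[|//]]]]] _ _;
  rewrite /valueH !trig5E /=; field: g2.
Qed.

(** The nonzero entries are affine in [g], and [3 / 2 < g < 5 / 3] makes them positive. *)
Lemma table_HP i j : (0 <= table (Phi_H R) i j) *
  ((table (Phi_H R) i j == 0) = zeroH i j).
Proof.
rewrite -table_modn /zeroH table_HE ?ltn_mod //.
have /andP[g_gt g_lt] := golden_bounds (golden_gt0 R) (golden_eq R).
have pos (a : R) : 0 < a -> (0 <= a) * ((a == 0) = false).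
  by move=> a0; rewrite ltW // gt_eqF.
have : (i %% 5 < 5)%N /\ (j %% 5 < 5)%N by rewrite !ltn_mod.
move: (i %% 5)%N (j %% 5)%N => {i j} [|[|[|[|[|?]]]]] [|[|[|[|[|?]]]]] [] // _ _;
  by rewrite /valueH /=; first [by rewrite lexx eqxx|by apply: pos; lra].
Qed.

Definition state (v : label) : 'M[R]_3 :=
  match v with
  | inl (inl (k, l)) => omega R k *m (omega R l)^T
  | inl (inr a) => transf a
  | inr (a, b) => transf a *m Phi_H R *m (transf b)^T
  end.

Lemma table_state v i j : (0 <= table (state v) i j) *
  ((table (state v) i j == 0) = vanish v (i, j)).
Proof.
case: v => [[[k l]|a]|[a b]] /=.
- rewrite /table joint_outer !omegaE !eps_dot mulf_eq0 !overlapP.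
  by rewrite mulr_ge0 ?overlapP.
(* [transf a] is treated as the image of the identity, with trivial action on the right. *)
- by rewrite /table -[transf a]mulmx1 -[_ *m 1%:M]mulmx1 -trmx1 joint_move
    trmx1 mul1mx transf_eps /joint mulmx1 eps_dot !overlapP.
by rewrite table_transf !table_HP.
Qed.

Lemma state_unit v : joint (state v) (unit_effect R) (unit_effect R) = 1.
Proof.
have uw n : ((unit_effect R)^T *m eps R n) 0 0 = 1.
  by rewrite !mxE !big_ord_recl big_ord0 !mxE /=; ring.
case: v => [[[k l]|a]|[a b]] /=.
- by rewrite joint_outer !omegaE !uw mulr1.
- rewrite -[transf a]mulmx1 -[_ *m 1%:M]mulmx1 -trmx1 joint_move.
  rewrite trmx1 mul1mx transf_unit /joint mulmx1.
  by rewrite !mxE !big_ord_recl big_ord0 !mxE /=; ring.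
rewrite joint_move !transf_unit /joint !mxE !big_ord_recl !big_ord0 !mxE.
by rewrite !big_ord_recl !big_ord0 !mxE /=; ring.
Qed.

Lemma max_tensorE : max_tensor R =
  [set Phi | joint Phi (unit_effect R) (unit_effect R) = 1 /\
    forall k : 'I_5 * 'I_5, 0 <= table Phi k.1 k.2].
Proof.
have r1 : 0 < (1 + r ^+ 2)^-1 by rewrite invr_gt0 ltr_pwDl ?sqr_ge0.
have effE Phi (i j : 'I_5) : joint Phi (ray_effect R i) (ray_effect R j) =
    (1 + r ^+ 2)^-1 * ((1 + r ^+ 2)^-1 * table Phi i.+1 j.+1).
  rewrite !ray_effectE /joint -scalemxAr [(_ *: _)^T]linearZ /= -!scalemxAl.
  by rewrite [LHS]mxE [in LHS]mxE.
rewrite /max_tensor; apply/seteqP; split=> Phi [Phi1 Phi0]; split=> //; [case=> i j /=|move=> i j].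
  (* Effects are numbered 1 to 5 and cells 0 to 4, so a cell index is reached from its predecessor
     [m + 4] modulo 5. *)
  have ord_pred (m : 'I_5) : exists n : 'I_5, (n.+1 %% 5)%N = m.
    exists (inord ((m + 4) %% 5)); rewrite inordK ?ltn_mod //.
    by rewrite -addn1 modnDml -addnA addnC modnDl modn_small.
  have [[i' <-] [j' <-]] := (ord_pred i, ord_pred j).
  by have := Phi0 i' j'; rewrite table_modn effE !pmulr_rge0.
rewrite effE !pmulr_rge0 // -table_modn.
exact: (Phi0 (Ordinal (ltn_pmod i.+1 (isT : 0 < 5)%N),
              Ordinal (ltn_pmod j.+1 (isT : 0 < 5)%N))).
Qed.

Lemma extreme_points_max_tensor : extreme_points (max_tensor R) = range state.
Proof.
have g0 := golden_gt0 R; have g2 := golden_eq R.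
have cellP (c : nat * nat) : c \in cells -> exists k : 'I_5 * 'I_5, c = (k.1 : nat, k.2 : nat).
  by case/allpairsP => -[i j] []; rewrite !mem_iota /= => i5 j5 ->;
  by exists (Ordinal i5, Ordinal j5).
rewrite max_tensorE.
pose h (Phi : 'M[R]_3) := joint Phi (unit_effect R) (unit_effect R).
pose L (k : 'I_5 * 'I_5) (Phi : 'M[R]_3) := table Phi k.1 k.2.
apply: (extreme_points_polyhedron (h := h) (L := L) (a := 25)).
- exact: joint_affine.
- by move=> k; exact: joint_affine.
- by move=> p q pq; apply: table_inj => i j; exact: (pq (i, j)).
- by move=> p; rewrite /h -table_sum pair_big.
- by [].
- by move=> v; split=> [|k]; rewrite /h /L ?state_unit ?table_state.
- move=> p [p1 p0].
  have [|v pv] := golden_table_supp g0 g2 (x := table p).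
    split=> [i j|i|j|]; [|exact: table_row|exact: table_col|by rewrite table_sum -/(h p) p1 mulr1].
    rewrite -table_modn.
    exact: (p0 (Ordinal (ltn_pmod i (isT : 0 < 5)%N), Ordinal (ltn_pmod j (isT : 0 < 5)%N))).
  exists v => k; rewrite /L table_state => kv; apply: (pv (k.1 : nat, k.2 : nat)).
  by rewrite mem_filter kv allpairs_f ?mem_iota /=.
move=> v w vw; apply: supp_antichain => c; rewrite mem_filter => /andP[cv /cellP[k ck]].
by have := vw k; rewrite /L !table_state -ck; apply.
Qed.

End Vertices.

(** * Counting and equivalence classes *)

Lemma card_range_finType (T : finType) (U : Type) (f : T -> U) :
  injective f -> range f #= `I_#|T|.
Proof.
move=> f_inj; have -> : `I_#|T| = range (fun t : T => nat_of_ord (enum_rank t)).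
  apply/seteqP; split=> [n /= nT|_ [t _ <-]] /=; last exact: ltn_ord.
  by exists (enum_val (Ordinal nT)) => //; rewrite enum_valK.
apply: card_eq_trans (inj_card_eq (in2W f_inj)) _.
rewrite card_eq_sym; apply: inj_card_eq; apply: in2W => t u /val_inj.
exact: enum_rank_inj.
Qed.

(** The vertices span, so the dihedral group laws of the matrices reduce to these laws on residues,
    checked by enumeration. *)
Lemma rot5_group :
  [/\ exists e, forall n, (n < 5)%N -> rot5 e n = n %[mod 5],
      forall a b, exists c, forall n, (n < 5)%N -> rot5 b (rot5 a n) = rot5 c n %[mod 5] &
      forall a, exists b, forall n, (n < 5)%N -> rot5 a (rot5 b n) = n %[mod 5]].
Proof.
have allI (q : pred nat) : all q (iota 0 5) -> forall n, (n < 5)%N -> q n.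
  by move=> /allP qI n n5; apply: qI; rewrite mem_iota.
split.
(* The ordinal 4 stands for 5, a full turn. *)
- by exists (@Ordinal 5 4 isT, false) => n n5; apply/eqP; move: n n5; exact: allI.
- move=> a b; have : all (fun a => all (fun b => has (fun c => all
      (fun n => rot5 b (rot5 a n) == rot5 c n %[mod 5]) (iota 0 5))
      dihedral5) dihedral5) dihedral5 by vm_compute.
  move=> /allP/(_ a (mem_dihedral5 a))/allP/(_ b (mem_dihedral5 b))/hasP[c _ /allI cP].
  by exists c => n /cP/eqP.
move=> a; have : all (fun a => has (fun b => all
    (fun n => rot5 a (rot5 b n) == n %[mod 5]) (iota 0 5)) dihedral5) dihedral5.
  by vm_compute.
move=> /allP/(_ a (mem_dihedral5 a))/hasP[b _ /allI bP].
by exists b => n /bP/eqP.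
Qed.

Section Classes.

Variable R : realType.
Local Notation T := (transf R).

(** * The group of reversible transformations *)

Lemma eps_transf a n : (eps R n)^T *m T a = (eps R (rot5 a n))^T.
Proof. by rewrite -transf_eps trmx_mul trmxK. Qed.

Lemma eps_modn m n : m = n %[mod 5] -> eps R m = eps R n.
Proof.
have cosm := golden_modn (golden_eq R) (golden_cos5 R).
have sinm := golden_modn (golden_eq R) (golden_sin5 R).
by move=> mn; rewrite /eps -(cosm m) -(sinm m) mn cosm sinm.
Qed.

Lemma transf1 : exists e, T e = 1%:M.
Proof.
have [[e eP] _ _] := rot5_group; exists e; apply: eps_inj => n n5.
by rewrite eps_transf mulmx1 (eps_modn (eP n n5)).
Qed.

Lemma transfM a b : exists c, T a *m T b = T c.
Proof.
have [_ /(_ a b)[c cP] _] := rot5_group; exists c; apply: eps_inj => n n5.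
by rewrite mulmxA !eps_transf (eps_modn (cP n n5)).
Qed.

Lemma transfV a : exists b, T a *m T b = 1%:M.
Proof.
have [_ _ /(_ a)[b bP]] := rot5_group; exists b; apply: mulmx1C.
apply: eps_inj => n n5; by rewrite mulmxA !eps_transf mulmx1 (eps_modn (bP n n5)).
Qed.

Lemma transf_orthogonal a : (T a)^T *m T a = 1%:M.
Proof.
have cs := sin2cos2 (angle5 R a.1); rewrite /transf /rev_transf.
have : (-1) ^+ a.2 ^+ 2 = 1 :> R by rewrite sqrr_sign.
move: ((-1) ^+ a.2 : R) => t t2.
apply/matrixP => i j; rewrite !mxE !big_ord_recl big_ord0 !mxE.
by case: i => -[|[|[|//]]] ?; case: j => -[|[|[|//]]] ? /=;
  rewrite ?mulr1n ?mulr0n; ring: cs t2.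
Qed.

Lemma transfT a : exists b, (T a)^T = T b.
Proof.
have [b ab1] := transfV a; exists b.
by rewrite -[LHS]mulmx1 -ab1 mulmxA transf_orthogonal mul1mx.
Qed.

(** Since [T a *m (T b)^T] is again a transformation, the two-sided orbit of the identity is the
    group itself. *)
Definition class_J : set 'M[R]_3 := range T.

Definition class_H : set 'M[R]_3 :=
  range (fun p : ('I_5 * bool) * ('I_5 * bool) => T p.1 *m Phi_H R *m (T p.2)^T).

(** Equal states have equal supports. *)
Lemma state_inj : injective (state R).
Proof.
move=> v w vw; apply: supp_antichain => c; rewrite mem_filter => /andP[+ _].
by case: c => i j; rewrite -!(table_state R _ i j).2 vw.
Qed.

Lemma product_statesE : product_states R = range (state R \o inl \o inl).
Proof.
apply/seteqP; split=> [_ [k [l ->]]|_ [[k l] _ <-]]; last by exists k, l.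
by exists (k, l).
Qed.

Lemma entangled_pointsE : entangled_points R = class_J `|` class_H.
Proof.
rewrite /entangled_points extreme_points_max_tensor product_statesE.
apply/seteqP; split=> [_ [[[[p|a]|[a b]] _ <-] np]|_ [[a _ <-]|[[a b] _ <-]]].
- by case: np; exists p.
- by left; exists a.
- by right; exists (a, b).
- by split; [exists (inl (inr a))|case=> p _ /(@state_inj (inl (inl p)) (inl (inr a)))].
by split; [exists (inr (a, b))|case=> p _ /(@state_inj (inl (inl p)) (inr (a, b)))].
Qed.

Lemma local_equivP (Phi Psi : 'M[R]_3) : local_equiv Phi Psi <->
  exists a b, Psi = T a *m Phi *m (T b)^T.
Proof.
split=> [[k1 [k2 [s1 [s2 ->]]]]|[[k1 s1] [[k2 s2] ->]]].
  by exists (k1, s1), (k2, s2).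
by exists k1, k2, s1, s2.
Qed.

Lemma class_JE a :
  [set Psi | entangled_points R Psi /\ local_equiv (T a) Psi] = class_J.
Proof.
apply/seteqP; split=> [_ [_ /local_equivP[x [y ->]]]|_ [d _ <-]] /=.
  have [z ->] := transfT y; have [u ->] := transfM x a.
  by have [v ->] := transfM u z; exists v.
split; first by rewrite entangled_pointsE; left; exists d.
(* Acting on the left by [T d] times the inverse of [T a] suffices. *)
have [e e1] := transf1; have [b ab1] := transfV a; have [x xE] := transfM d b.
apply/local_equivP; exists x, e.
by rewrite e1 trmx1 mulmx1 -xE -mulmxA (mulmx1C ab1) mulmx1.
Qed.

Lemma class_HE a b :
  [set Psi | entangled_points R Psi /\
    local_equiv (T a *m Phi_H R *m (T b)^T) Psi] = class_H.
Proof.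
apply/seteqP; split=> [_ [_ /local_equivP[x [y ->]]]|_ [[c d] _ <-]] /=.
  have [u uE] := transfM x a; have [v vE] := transfM y b.
  by exists (u, v) => //=; rewrite -uE -vE trmx_mul !mulmxA.
split; first by rewrite entangled_pointsE; right; exists (c, d).
have [a' aa1] := transfV a; have [b' bb1] := transfV b.
(* The two sides are corrected independently, by [T c] and [T d] times the inverses of [T a] and
   [T b]. *)
have [x xE] := transfM c a'; have [y yE] := transfM d b'.
apply/local_equivP; exists x, y; rewrite -xE -yE trmx_mul !mulmxA.
rewrite -(mulmxA _ (T a')) (mulmx1C aa1) mulmx1 -(mulmxA _ (T b)^T) -trmx_mul.
by rewrite (mulmx1C bb1) trmx1 mulmx1.
Qed.

Lemma entangled_classesE : entangled_classes R = [set class_J; class_H].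
Proof.
have [e _] := transf1.
apply/seteqP; split=> [_ [Phi + <-]|_ [->|->]].
- by rewrite {1}entangled_pointsE => -[[a _ <-]|[[a b] _ <-]];
    [left; exact: class_JE|right; exact: class_HE].
- exists (T e); last exact: class_JE.
  by rewrite entangled_pointsE; left; exists e.
exists (T e *m Phi_H R *m (T e)^T); last exact: class_HE.
by rewrite entangled_pointsE; right; exists (e, e).
Qed.

End Classes.

Arguments class_J R : clear implicits.
Arguments class_H R : clear implicits.

Theorem mainTheorem9 (R : realType) :
  extreme_points (max_tensor R) #= `I_135 /\
  (product_states R `<=` extreme_points (max_tensor R) /\
   product_states R #= `I_25) /\
  entangled_points R #= `I_110 /\
  exists CJ CH : set 'M[R]_3,
    entangled_classes R = [set CJ; CH] /\
    (CJ #= `I_10 /\ CJ (Phi_J R)) /\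
    (CH #= `I_100 /\ CH (Phi_H R)).
Proof.
have inj := @state_inj R; have [e e1] := transf1 R.
split; [|split; [split|split]].
- rewrite extreme_points_max_tensor.
  by have := card_range_finType inj; rewrite !(card_sum, card_prod, card_ord, card_bool).
- rewrite extreme_points_max_tensor product_statesE => _ [p _ <-].
  by exists (inl (inl p)).
- rewrite product_statesE; have := @card_range_finType _ _ (state R \o inl \o inl).
  by rewrite card_prod !card_ord; apply => p q /inj[].
(* The entangled points are reindexed by the last two kinds of labels, which gives 10 + 100. *)
- have -> : entangled_points R = range (fun v : 'I_5 * bool + ('I_5 * bool) * ('I_5 * bool) =>
      state R (match v with inl a => inl (inr a) | inr p => inr p end)).
    rewrite entangled_pointsE; apply/seteqP; split=> [_ [[a _ <-]|[[a b] _ <-]]|_ [[a|[a b]] _ <-]].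
    + by exists (inl a).
    + by exists (inr (a, b)).
    + by left; exists a.
    by right; exists (a, b).
  have := @card_range_finType _ _ (fun v : 'I_5 * bool + ('I_5 * bool) * ('I_5 * bool) =>
      state R (match v with inl a => inl (inr a) | inr p => inr p end)).
  rewrite !(card_sum, card_prod, card_ord, card_bool); apply.
  by move=> [a|p] [b|q] /inj // [->].
exists (class_J R), (class_H R); split; [exact: entangled_classesE|split; split].
- have := @card_range_finType _ _ (transf R).
  by rewrite card_prod card_ord card_bool; apply => a b /(inj (inl (inr a)) (inl (inr b)))[].
- by exists e.
- have := @card_range_finType _ _ (fun p : ('I_5 * bool) * ('I_5 * bool) =>
    transf R p.1 *m Phi_H R *m (transf R p.2)^T).
  rewrite !(card_prod, card_ord, card_bool); apply.
  by move=> [a b] [c d] /(inj (inr (a, b)) (inr (c, d)))[-> ->].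
by exists (e, e) => //=; rewrite e1 trmx1 mulmx1 mul1mx.
Qed.
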